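(* Let $w_1,w_2,w_3$ be positive integers, $n\ge0$ an integer, and $y_1,y_2\in\mathbb{Z}_p$. Then \begin{align*} &w_1^{n-1}\sum_{k=0}^n\binom{n}{k}B_{k,q^{w_1w_2}}(w_3y_1)\,w_3^{n-k}w_2^k\sum_{i=0}^{w_1-1}q^{w_2w_3i}B_{n-k,q^{w_1w_3}}\Big(w_2y_2+\frac{w_2}{w_1}i\Big)\\ &=w_1^{n-1}\sum_{k=0}^n\binom{n}{k}B_{k,q^{w_1w_3}}(w_2y_1)\,w_2^{n-k}w_3^k\sum_{i=0}^{w_1-1}q^{w_2w_3i}B_{n-k,q^{w_1w_2}}\Big(w_3y_2+\frac{w_3}{w_1}i\Big)\\ &=w_2^{n-1}\sum_{k=0}^n\binom{n}{k}B_{k,q^{w_1w_2}}(w_3y_1)\,w_3^{n-k}w_1^k\sum_{i=0}^{w_2-1}q^{w_1w_3i}B_{n-k,q^{w_2w_3}}\Big(w_1y_2+\frac{w_1}{w_2}i\Big)\\ &=w_2^{n-1}\sum_{k=0}^n\binom{n}{k}B_{k,q^{w_2w_3}}(w_1y_1)\,w_1^{n-k}w_3^k\sum_{i=0}^{w_2-1}q^{w_1w_3i}B_{n-k,q^{w_1w_2}}\Big(w_3y_2+\frac{w_3}{w_2}i\Big)\\ &=w_3^{n-1}\sum_{k=0}^n\binom{n}{k}B_{k,q^{w_1w_3}}(w_2y_1)\,w_2^{n-k}w_1^k\sum_{i=0}^{w_3-1}q^{w_1w_2i}B_{n-k,q^{w_2w_3}}\Big(w_1y_2+\frac{w_1}{w_3}i\Big)\\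 &=w_3^{n-1}\sum_{k=0}^n\binom{n}{k}B_{k,q^{w_2w_3}}(w_1y_1)\,w_1^{n-k}w_2^k\sum_{i=0}^{w_3-1}q^{w_1w_2i}B_{n-k,q^{w_1w_3}}\Big(w_2y_2+\frac{w_2}{w_3}i\Big). \end{align*}
   Context: Let $p$ be a prime, $\mathbb{C}_p$ the completion of an algebraic closure of $\mathbb{Q}_p$, and $|\cdot|_p$ the absolute value on $\mathbb{C}_p$ with $|p|_p=1/p$. Fix $q\in\mathbb{C}_p$ with $q\neq 1$ and $|q-1|_p<p^{-1/(p-1)}$; for every positive integer $w$, $Q=q^w$ also satisfies these conditions. For such $Q$, the $Q$-Bernoulli numbers are defined by $\frac{\log Q+t}{Qe^t-1}=\sum_{n\ge0}B_{n,Q}\frac{t^n}{n!}$ ($\log$ the $p$-adic logarithm), and the $Q$-Bernoulli polynomials by $\frac{\log Q+t}{Qe^t-1}e^{xt}=\sum_{n\ge0}B_{n,Q}(x)\frac{t^n}{n!}$, i.e. $B_{n,Q}(x)=\sum_{j=0}^n\binom{n}{j}B_{j,Q}x^{n-j}$ (a polynomial, evaluated at elements of $\mathbb{C}_p$). *)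

(* Defs.v *)
From HB Require Import structures.
From mathcomp Require Export all_boot all_order all_algebra.
From mathcomp Require Export all_classical all_reals all_analysis.

Set Implicit Arguments.
Unset Strict Implicit.
Unset Printing Implicit Defensive.

Import Order.TTheory GRing.Theory Num.Theory.
Import numFieldNormedType.Exports.

Local Open Scope classical_set_scope.
Local Open Scope ring_scope.

Section ValuedField.
Variables (R : realType) (K : fieldType) (abs : K -> R).

Definition abs_cvg (u : nat -> K) (l : K) : Prop :=
  (fun n => abs (u n - l)) @ \oo --> (0 : R).

Definition abs_cauchy (u : nat -> K) : Prop :=
  forall e : R, 0 < e ->
    exists N : nat, forall m n, (N <= m)%N -> (N <= n)%N -> abs (u m - u n) < e.

Definition abs_complete : Prop :=
  forall u, abs_cauchy u -> exists l, abs_cvg u l.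

Definition abs_dense (A : set K) : Prop :=
  forall (x : K) (e : R), 0 < e -> exists2 a, A a & abs (x - a) < e.

(* The closure of the prime field; in a complete K of characteristic 0 whose
   absolute value restricts to the p-adic one on rat, this is Q_p. *)
Definition Qp : set K :=
  [set x | forall e : R, 0 < e -> exists r : rat, abs (x - ratr r) < e].

Definition Zp : set K := [set x | Qp x /\ abs x <= 1].

Definition Qpbar : set K :=
  [set x | exists P : {poly K}, [/\ P != 0, forall i, Qp P`_i & root P x]].

(* K with abs is C_p, i.e. the completion of an algebraic closure of Q_p with
   the absolute value normalized by |p| = 1/p. Characteristic 0 follows from
   this normalization; these conditions determine (K, abs) up to isometric
   isomorphism. *)
Record is_Cp (p : nat) : Prop := IsCp {
  Cp_abs_ge0 : forall x, 0 <= abs x;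
  Cp_abs_eq0 : forall x, abs x = 0 -> x = 0;
  Cp_absM : forall x y, abs (x * y) = abs x * abs y;
  Cp_absD : forall x y, abs (x + y) <= Num.max (abs x) (abs y);
  Cp_absp : abs p%:R = p%:R^-1;
  Cp_complete : abs_complete;
  Cp_Qpbar_closed : forall P : {poly K}, (forall i, Qpbar P`_i) ->
    (1 < size P)%N -> exists2 x, Qpbar x & root P x;
  Cp_Qpbar_dense : abs_dense Qpbar
}.

(* log x = \sum_(k >= 1) (-1)^(k+1) (x - 1)^k / k; 0 if the series diverges. *)
Definition plog (x : K) : K :=
  xget 0 [set l | abs_cvg
    (fun n => \sum_(1 <= k < n.+1) (-1) ^+ k.+1 * (x - 1) ^+ k / k%:R) l].

End ValuedField.

(* The series \sum_n f n t^n is represented by its coefficients. *)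
Section FormalSeries.
Variable K : fieldType.
Implicit Types f g : nat -> K.

Definition fps_mul f g : nat -> K := fun n => \sum_(i < n.+1) f i * g (n - i)%N.

Fixpoint fps_inv_seq f (n : nat) : seq K :=
  if n is m.+1 then
    let s := fps_inv_seq f m in
    rcons s (- (f 0)^-1 * \sum_(i < m.+1) s`_i * f (m.+1 - i)%N)
  else [:: (f 0)^-1].

Definition fps_inv f : nat -> K := fun n => (fps_inv_seq f n)`_n.

Definition fps_exp (c : K) : nat -> K := fun n => c ^+ n / n`!%:R.

Lemma size_fps_inv_seq f n : size (fps_inv_seq f n) = n.+1.
Proof. by elim: n => //= n IHn; rewrite size_rcons IHn. Qed.

Lemma fps_inv_seqE f n i : (i <= n)%N -> (fps_inv_seq f n)`_i = fps_inv f i.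
Proof.
elim: n => [|n IHn]; first by rewrite leqn0 => /eqP ->.
rewrite leq_eqVlt => /predU1P[-> //|lt_in].
by rewrite /= nth_rcons size_fps_inv_seq lt_in IHn.
Qed.

Lemma fps_mulVf f : f 0 != 0 ->
  forall n, fps_mul (fps_inv f) f n = (n == 0)%:R.
Proof.
move=> f0 [|n]; first by rewrite /fps_mul big_ord1 /fps_inv /= mulVf.
rewrite /fps_mul big_ord_recr /= subnn {2}/fps_inv /= nth_rcons.
rewrite size_fps_inv_seq ltnn eqxx mulrAC mulNr mulVf // mulN1r.
apply/eqP; rewrite subr_eq0; apply/eqP/eq_bigr => i _.
by rewrite fps_inv_seqE // -ltnS.
Qed.

End FormalSeries.

Section QBernoulli.
Variables (R : realType) (K : fieldType) (abs : K -> R).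

(* The coefficients of (log Q + t) / (Q e^t - 1). *)
Definition qbern_series (Q : K) : nat -> K :=
  fps_mul
    (fun n => plog abs Q *+ (n == 0) + (n == 1)%:R)
    (fps_inv (fun n => Q * fps_exp 1 n - (n == 0)%:R)).

Definition qbern (n : nat) (Q : K) : K := n`!%:R * qbern_series Q n.

Definition qbern_poly (n : nat) (Q : K) : {poly K} :=
  \sum_(j < n.+1) ('C(n, j)%:R * qbern j Q) *: 'X^(n - j).

(* n! [t^n] (log Q + t) / (Q e^t - 1) * e^(x t) *)
Lemma qbern_poly_gen (n : nat) (Q x : K) : [pchar K] =i pred0 ->
  (qbern_poly n Q).[x] = n`!%:R * fps_mul (qbern_series Q) (fps_exp x) n.
Proof.
move=> /pcharf0P K0; rewrite /qbern_poly horner_sum /fps_mul mulr_sumr.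
apply: eq_bigr => j _; rewrite hornerZ hornerXn /qbern /fps_exp.
have jn : (j <= n)%N by rewrite -ltnS.
have nz : (n - j)`!%:R != 0 :> K by rewrite K0 -lt0n fact_gt0.
apply: (mulIf nz); rewrite !mulrA mulfVK // -(bin_fact jn) !natrM.
by rewrite mulrAC -!mulrA; congr (_ * (_ * _)); rewrite mulrCA !mulrA.
Qed.

End QBernoulli.

(* Main.v *)
From HB Require Import structures.
From mathcomp Require Import ring.
Require Import Defs.

(* Write u = q e^t. Since log (q^m) = m log q, the substitution t -> m t turns
   (log Q + t) / (Q e^t - 1) at Q = q^m into m (log q + t) / (u^m - 1). The
   exponential generating function of each of the six expressions then becomes,
   after summing a geometric series in u, one and the same expression that is
   symmetric in w1, w2, w3. Two facts about C_p are needed: q^m <> 1 for m > 0,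
   so that u^m - 1 is invertible, and log (q^m) = m log q. *)

Set Implicit Arguments.
Unset Strict Implicit.
Unset Printing Implicit Defensive.

Import Order.TTheory GRing.Theory Num.Theory.
Import numFieldNormedType.Exports.

Local Open Scope classical_set_scope.
Local Open Scope ring_scope.

(** * The p-adic logarithm and roots of unity *)

(** With s the square root of r, j s^j is at most 1 + s + ... + s^(j-1) <= 1/(1 - s), and the other
    factor s^j tends to 0. This controls the logarithm series, where |1/j| is only known to be at
    most j. *)
Lemma natr_expr_small (R : realType) (r e : R) : 0 <= r < 1 -> 0 < e ->
  exists N, forall j, (N <= j)%N -> j%:R * r ^+ j < e.
Proof.
move=> /andP[r0 r1] e0; pose s := Num.sqrt r.
have s0 : 0 <= s by exact: sqrtr_ge0.
have rE : r = s ^+ 2 by rewrite sqr_sqrtr.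
have s1 : s < 1 by rewrite -(expr_lt1 (n := 2)) // -rE.
have s1' : 0 < 1 - s by rewrite subr_gt0.
have js j : j%:R * s ^+ j <= (1 - s)^-1.
  rewrite -[leRHS]mul1r ler_pdivlMr //.
  apply: (@le_trans _ _ (1 - s ^+ j)); last by rewrite gerBl exprn_ge0.
  rewrite -[1 in leRHS](expr1n _ j) subrXX [leRHS]mulrC ler_wpM2r ?(ltW s1') //.
  rewrite -[j in j%:R]card_ord -sumr_const mulr_suml; apply: ler_sum => i _.
  rewrite expr1n !mul1r; apply: ler_wiXn2l => //; first exact: ltW.
  exact: ltnW.
have /cvgr0Pnorm_lt /(_ (e * (1 - s))) : (fun n => s ^+ n) @ \oo --> (0 : R).
  by apply: cvg_expr; rewrite ger0_norm.
case=> [|N _ HN]; first exact: mulr_gt0.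
exists N => j /HN; rewrite /= ger0_norm ?exprn_ge0 // => sj.
rewrite rE exprAC expr2 mulrA.
apply: (@le_lt_trans _ _ ((1 - s)^-1 * s ^+ j)).
  by rewrite ler_wpM2r ?exprn_ge0.
by rewrite mulrC ltr_pdivrMr.
Qed.

(** * Ultrametric estimates *)

Section PadicLogarithm.
Variables (p : nat) (p_prime : prime p).
Variables (R : realType) (K : fieldType) (abs : K -> R) (K_Cp : is_Cp abs p).

Let abs_ge0 := Cp_abs_ge0 K_Cp.
Let abs_eq0 := Cp_abs_eq0 K_Cp.
Let absM := Cp_absM K_Cp.
Let absp := Cp_absp K_Cp.

(** [is_Cp] asserts only the converse implication. Multiplicativity at p * 0 gives |0| = |0| / p,
    and p is not 1. *)
Lemma Cp_abs0 : abs 0 = 0.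
Proof.
have p1 := prime_gt1 p_prime.
have := absM p%:R 0; rewrite mulr0 absp.
move/eqP; rewrite eq_sym -subr_eq0 -[X in _ - X]mul1r -mulrBl mulf_eq0.
rewrite subr_eq0 => /predU1P[]; last by move/eqP.
move/(congr1 GRing.inv); rewrite invrK invr1 => /eqP.
by rewrite pnatr_eq1 => /eqP p1'; rewrite p1' in p1.
Qed.

Lemma Cp_abs1 : abs 1 = 1.
Proof.
have := absM 1 1; rewrite mul1r => /eqP.
rewrite -subr_eq0 -[X in X - _]mulr1 -mulrBr mulf_eq0 => /orP[/eqP /abs_eq0/eqP|].
  by rewrite oner_eq0.
by rewrite subr_eq0 => /eqP.
Qed.

Lemma Cp_absX x n : abs (x ^+ n) = abs x ^+ n.
Proof.
by elim: n => [|n IHn]; rewrite ?Cp_abs1 // !exprS absM IHn.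
Qed.

Lemma Cp_absN x : abs (- x) = abs x.
Proof.
have : abs (-1) ^+ 2 == 1 by rewrite -Cp_absX sqrrN expr1n Cp_abs1.
rewrite sqrp_eq1 ?abs_ge0 // => /eqP N1.
by rewrite -mulN1r absM N1 mul1r.
Qed.

Lemma Cp_absD_le x y e : abs x <= e -> abs y <= e -> abs (x + y) <= e.
Proof. by move=> xe ye; rewrite (le_trans (Cp_absD K_Cp _ _)) // ge_max xe. Qed.

Lemma Cp_absD_lt x y e : abs x < e -> abs y < e -> abs (x + y) < e.
Proof. by move=> xe ye; rewrite (le_lt_trans (Cp_absD K_Cp _ _)) // gt_max xe. Qed.

Lemma Cp_abs_sum_le (I : Type) (s : seq I) (P : pred I) (F : I -> K) e :
  0 <= e -> (forall i, P i -> abs (F i) <= e) -> abs (\sum_(i <- s | P i) F i) <= e.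
Proof.
move=> e0 Fe; elim/big_ind: _ => //; first by rewrite Cp_abs0.
by move=> x y; exact: Cp_absD_le.
Qed.

(** If x + y were smaller than x, then x = (x + y) - y would be smaller than itself. *)
Lemma Cp_absD_dom x y : abs y < abs x -> abs (x + y) = abs x.
Proof.
move=> yx; apply/eqP; rewrite eq_le Cp_absD_le ?(ltW yx) //= leNgt.
apply/negP => xyx.
have: abs (x + y + - y) < abs x by rewrite Cp_absD_lt ?Cp_absN.
by rewrite addrK ltxx.
Qed.

Lemma Cp_abs_nat_le1 n : abs n%:R <= 1.
Proof.
elim: n => [|n IHn]; first by rewrite Cp_abs0.
by rewrite -natr1 Cp_absD_le ?Cp_abs1.
Qed.

Lemma Cp_absp_lt1 : abs p%:R < 1.
Proof. by rewrite absp invf_lt1 ?ltr0n ?ltr1n ?prime_gt0 ?prime_gt1. Qed.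

(** Bezout gives a m = b p + 1 with |b p| < 1, so |a m| = 1; since |a| <= 1, this forces |m| >=
    1. *)
Lemma Cp_abs_coprime m : coprime p m -> abs m%:R = 1.
Proof.
move=> pm; apply/eqP; rewrite eq_le Cp_abs_nat_le1 /=.
have [m0|m0] := posnP m.
  move: pm; rewrite m0 /coprime gcdn0 => /eqP p1'; have := prime_gt1 p_prime.
  by rewrite p1'.
case: (egcdnP p m0) => a b mE _.
have {}mE : (a * m = b * p + 1)%N by rewrite mE gcdnC (eqP pm).
have : abs (a%:R * m%:R) = 1.
  rewrite -natrM mE natrD addrC Cp_absD_dom ?Cp_abs1 // natrM absM.
  apply: le_lt_trans Cp_absp_lt1.
  by rewrite -[leRHS]mul1r ler_wpM2r ?abs_ge0 ?Cp_abs_nat_le1.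
rewrite absM => <-.
by rewrite -[leRHS]mul1r ler_wpM2r ?abs_ge0 ?Cp_abs_nat_le1.
Qed.

(** If p^v is the exact power of p in n, then |n| = p^(-v) and p^v <= n. The bound yields both
    characteristic 0 and |1/j| <= j. *)
Lemma Cp_abs_nat_ge n : (0 < n)%N -> n%:R^-1 <= abs n%:R.
Proof.
move=> n0; have [m pm nE] := pfactor_coprime p_prime n0.
set v := logn p n in nE.
have ->: abs n%:R = (p%:R ^+ v)^-1.
  by rewrite nE natrM absM Cp_abs_coprime // mul1r natrX Cp_absX absp exprVn.
rewrite -natrX lef_pV2 ?posrE ?ltr0n ?expn_gt0 ?(prime_gt0 p_prime) // ler_nat.
by rewrite dvdn_leq // nE dvdn_mull.
Qed.

Lemma Cp_natr_neq0 n : (0 < n)%N -> n%:R != 0 :> K.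
Proof.
move=> n0; apply/eqP => nz; have := Cp_abs_nat_ge n0.
by rewrite nz Cp_abs0 leNgt invr_gt0 ltr0n n0.
Qed.

Lemma Cp_pchar0 : [pchar K] =i pred0.
Proof.
by apply/pcharf0P => -[|n]; rewrite ?eqxx // (negbTE (Cp_natr_neq0 _)).
Qed.

Lemma Cp_absV x : abs x^-1 = (abs x)^-1.
Proof.
have [->|x0] := eqVneq x 0; first by rewrite invr0 Cp_abs0 invr0.
have ax0 : abs x != 0 by apply: contra_neq x0; exact: abs_eq0 _.
by apply: (mulfI ax0); rewrite -absM !mulfV // Cp_abs1.
Qed.

Lemma Cp_abs_invn j : abs j%:R^-1 <= j%:R.
Proof.
case: j => [|j]; first by rewrite invr0 Cp_abs0.
rewrite Cp_absV -[leRHS]invrK lef_pV2 ?Cp_abs_nat_ge // posrE ?invr_gt0 ?ltr0n //.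
by rewrite (lt_le_trans _ (Cp_abs_nat_ge _)) ?invr_gt0 ?ltr0n.
Qed.

(** * Convergence of the logarithm series *)

Lemma abs_cvgP (u : nat -> K) l : abs_cvg abs u l <->
  (forall e, 0 < e -> exists N, forall n, (N <= n)%N -> abs (u n - l) < e).
Proof.
split=> [/cvgr0Pnorm_lt ul e e0|ul].
  have [N _ HN] := ul _ e0; exists N => n /HN /=.
  by rewrite ger0_norm ?abs_ge0.
apply/cvgr0Pnorm_lt => e /ul[N HN]; exists N => // n /HN /=.
by rewrite ger0_norm ?abs_ge0.
Qed.

Lemma abs_cvg_unique u l l' : abs_cvg abs u l -> abs_cvg abs u l' -> l = l'.
Proof.
move=> /abs_cvgP ul /abs_cvgP ul'; apply/eqP; rewrite -subr_eq0; apply/eqP.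
apply: abs_eq0; apply/eqP; rewrite eq_le abs_ge0 andbT.
apply/ler_addgt0Pr => e e0; rewrite add0r; have [N HN] := ul _ e0; have [N' HN'] := ul' _ e0.
have -> : l - l' = - (u (maxn N N') - l) + (u (maxn N N') - l') by ring.
by rewrite ltW // Cp_absD_lt // ?Cp_absN ?HN ?HN' ?leq_maxl ?leq_maxr.
Qed.

(** The truncated series of log (1 + X), taken as a polynomial so that it can be differentiated,
    composed and tested for divisibility. *)
Definition log_poly (n : nat) : {poly K} :=
  \sum_(1 <= k < n.+1) ((-1) ^+ k.+1 / k%:R) *: 'X^k.

Lemma log_polyE n z :
  (log_poly n).[z] = \sum_(1 <= k < n.+1) (-1) ^+ k.+1 * z ^+ k / k%:R.
Proof.
rewrite /log_poly horner_sum; apply: eq_bigr => k _.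
by rewrite hornerZ hornerXn mulrAC.
Qed.

Lemma log_term_abs z c j : abs c <= 1 -> abs (c * z ^+ j / j%:R) <= j%:R * abs z ^+ j.
Proof.
move=> c1; rewrite !absM mulrC Cp_absX.
apply: ler_pM; rewrite ?Cp_abs_invn ?mulr_ge0 ?exprn_ge0 ?abs_ge0 //.
by rewrite -[leRHS]mul1r ler_wpM2r ?exprn_ge0 ?abs_ge0.
Qed.

Lemma log_poly_cauchy z : abs z < 1 -> abs_cauchy abs (fun n => (log_poly n).[z]).
Proof.
move=> z1 e e0.
have [|N HN] := @natr_expr_small R (abs z) e _ e0.
  by rewrite abs_ge0.
(* By the ultrametric inequality it is enough that each single term between m and n is small. *)
have key m n : (N <= m)%N -> (m <= n)%N -> abs ((log_poly n).[z] - (log_poly m).[z]) < e.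
  move=> Nm mn; rewrite !log_polyE (big_cat_nat (n := m.+1)) //= addrAC subrr add0r.
  rewrite big_seq_cond; elim/big_ind: _; first by rewrite Cp_abs0.
    by move=> x y; exact: Cp_absD_lt.
  move=> k; rewrite andbT mem_index_iota => /andP[mk _].
  apply: (le_lt_trans (log_term_abs _ _ _)).
    by rewrite Cp_absX Cp_absN Cp_abs1 expr1n.
  by rewrite HN // (leq_trans Nm) // ltnW.
exists N => m n Nm Nn; case/orP: (leq_total m n) => [mn|nm]; last exact: key.
by rewrite -opprB Cp_absN key.
Qed.

(** Completeness provides a limit, so the [xget] in [plog] returns a genuine limit and not its
    default 0. *)
Lemma plog_cvg x : abs (x - 1) < 1 ->
  abs_cvg abs (fun n => (log_poly n).[x - 1]) (plog abs x).
Proof.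
move=> x1; have [l hl] := Cp_complete K_Cp (log_poly_cauchy x1).
have E : (fun n => (log_poly n).[x - 1]) = (fun n =>
   \sum_(1 <= k < n.+1) (-1) ^+ k.+1 * (x - 1) ^+ k / k%:R).
  by apply/funext => n; exact: log_polyE.
rewrite E in hl *; rewrite /plog; exact: xgetPex (ex_intro _ l hl).
Qed.

(** * Polynomials over the valuation ring *)

Definition abs_le1_poly : pred {poly K} := fun P => all (fun c => abs c <= 1) P.

Lemma abs_le1_polyP (P : {poly K}) : reflect (forall i, abs P`_i <= 1) (abs_le1_poly P).
Proof.
apply: (iffP allP) => [H i|H c /(nthP 0)[i _ <-] //].
have [lt_i|le_i] := ltnP i (size P); first exact/H/mem_nth.
by rewrite nth_default // Cp_abs0.
Qed.

Lemma abs_le1_poly0 : abs_le1_poly 0.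
Proof. by apply/abs_le1_polyP => i; rewrite coef0 Cp_abs0. Qed.
Lemma abs_le1_poly1 : abs_le1_poly 1.
Proof. by apply/abs_le1_polyP => i; rewrite coef1 Cp_abs_nat_le1. Qed.
Lemma abs_le1_polyX : abs_le1_poly 'X.
Proof. by apply/abs_le1_polyP => i; rewrite coefX Cp_abs_nat_le1. Qed.
Lemma abs_le1_polyN P : abs_le1_poly P -> abs_le1_poly (- P).
Proof. by move=> /abs_le1_polyP HP; apply/abs_le1_polyP => i; rewrite coefN Cp_absN. Qed.
Lemma abs_le1_polyD P Q : abs_le1_poly P -> abs_le1_poly Q -> abs_le1_poly (P + Q).
Proof.
move=> /abs_le1_polyP HP /abs_le1_polyP HQ; apply/abs_le1_polyP => i.
by rewrite coefD Cp_absD_le.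
Qed.
Lemma abs_le1_polyM P Q : abs_le1_poly P -> abs_le1_poly Q -> abs_le1_poly (P * Q).
Proof.
move=> /abs_le1_polyP HP /abs_le1_polyP HQ; apply/abs_le1_polyP => i.
rewrite coefM; apply: Cp_abs_sum_le => // j _.
by rewrite absM mulr_ile1 ?abs_ge0.
Qed.
Lemma abs_le1_polyXn P n : abs_le1_poly P -> abs_le1_poly (P ^+ n).
Proof.
by move=> HP; elim: n => [|n IH]; rewrite ?abs_le1_poly1 // exprS abs_le1_polyM.
Qed.
Lemma abs_le1_poly_sum n (F : 'I_n -> {poly K}) :
  (forall i, abs_le1_poly (F i)) -> abs_le1_poly (\sum_(i < n) F i).
Proof.
move=> HF; elim/big_ind: _ => //; first exact: abs_le1_poly0.
exact: abs_le1_polyD.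
Qed.

(** * The logarithm of a power *)

Lemma deriv_log_poly n : (log_poly n)^`() = \sum_(i < n) (- 'X) ^+ i.
Proof.
rewrite /log_poly raddf_sum /= big_add1 /= big_mkord; apply: eq_bigr => i _.
rewrite derivZ derivXn /= -scaler_nat scalerA divfK ?Cp_natr_neq0 //.
by rewrite -signr_odd /= negbK signr_odd -scaleN1r exprZn.
Qed.

Lemma log_poly_coef0 n : (log_poly n)`_0 = 0.
Proof.
rewrite /log_poly coef_sum big_nat big1 // => k /andP[k0 _].
by rewrite coefZ coefXn (ltn_eqF k0) mulr0.
Qed.

Section PowerDefect.
Variables (N m : nat).
Hypothesis m_gt0 : (0 < m)%N.

Let P : {poly K} := (1 + 'X) ^+ m - 1.

(* log ((1 + X)^m) - m log (1 + X) with both logarithm series cut at degree N: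
   its derivative has integral coefficients and is divisible by X^N. *)
Definition log_defect : {poly K} := log_poly N \Po P - m%:R *: log_poly N.

Lemma deriv_log_defect : log_defect^`() =
  m%:R *: ((1 + 'X) ^+ m.-1 * \sum_(i < N) (- P) ^+ i - \sum_(i < N) (- 'X) ^+ i).
Proof.
rewrite /log_defect derivB derivZ deriv_comp deriv_log_poly linear_sum /=.
have -> : P^`() = m%:R *: (1 + 'X) ^+ m.-1.
  rewrite /P derivB deriv_exp derivC subr0 derivD derivC derivX add0r mul1r.
  by rewrite scaler_nat.
rewrite -scalerAr -scalerBr mulrC; congr (_ *: (_ * _ - _)).
by apply: eq_bigr => i _; rewrite rmorphXn /= rmorphN /= comp_polyX.
Qed.

Lemma deriv_log_defect_le1 : abs_le1_poly log_defect^`().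
Proof.
have HX1 : abs_le1_poly (1 + 'X) by rewrite abs_le1_polyD ?abs_le1_poly1 ?abs_le1_polyX.
have HP : abs_le1_poly P.
  by rewrite abs_le1_polyD ?abs_le1_polyXn // abs_le1_polyN ?abs_le1_poly1.
rewrite deriv_log_defect -mul_polyC abs_le1_polyM //.
  by apply/abs_le1_polyP => i; rewrite coefC; case: ifP => _; rewrite ?Cp_abs0 ?Cp_abs_nat_le1.
rewrite abs_le1_polyD ?abs_le1_polyN ?abs_le1_polyM ?abs_le1_polyXn //.
  by apply: abs_le1_poly_sum => i; rewrite abs_le1_polyXn ?abs_le1_polyN.
by apply: abs_le1_poly_sum => i; rewrite abs_le1_polyXn ?abs_le1_polyN ?abs_le1_polyX.
Qed.

(** Multiplication by 1 + X, which is coprime to X^N, makes both geometric sums telescope. What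
    remains is m ((-X)^N - (-P)^N), and X divides P. *)
Lemma deriv_log_defect_dvd : 'X^N %| log_defect^`().
Proof.
have geom (Y : {poly K}) : (1 + Y) * \sum_(i < N) (- Y) ^+ i = 1 - (- Y) ^+ N.
  rewrite -[RHS]opprB subrX1 -mulNr; congr (_ * _); ring.
have XP : 'X %| P by rewrite /P subrX1 addrAC subrr add0r dvdp_mulIl.
have cop : coprimep 'X^N (1 + 'X : {poly K}).
  rewrite coprimep_expl // coprimep_sym; have := coprimep_XsubC (1 + 'X : {poly K}) 0.
  by rewrite subr0 => ->; rewrite rootE !hornerE oner_eq0.
rewrite -(Gauss_dvdpr _ cop).
have -> : (1 + 'X) * log_defect^`() = m%:R *: ((- 'X) ^+ N - (- P) ^+ N).
  rewrite deriv_log_defect -scalerAr; congr (_ *: _).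
  rewrite mulrBr geom mulrA -exprS prednK //.
  by rewrite (_ : (1 + 'X) ^+ m = 1 + P) ?geom /P; ring.
rewrite dvdpZr ?Cp_natr_neq0 //; apply: dvdp_sub; first by rewrite exprNn dvdp_mull.
by rewrite exprNn dvdp_mull // dvdp_exp2r.
Qed.

(** A coefficient of index j > 0 is that of the derivative at j - 1, divided by j. Hence it vanishes
    for 1 <= j <= N and is at most j in absolute value beyond; the constant term vanishes because
    P(0) = 0. *)
Lemma log_defect_abs z e : 0 <= e ->
  (forall j, (N <= j)%N -> j%:R * abs z ^+ j <= e) -> abs log_defect.[z] <= e.
Proof.
move=> e0 He; rewrite horner_coef; apply: Cp_abs_sum_le => // -[j /= _] _.
case: j => [|j].
  have -> : log_defect`_0 = 0.
    rewrite -horner_coef0 /log_defect !hornerE horner_comp /P !hornerE.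
    by rewrite expr1n subrr horner_coef0 log_poly_coef0 mulr0 subrr.
  by rewrite mul0r Cp_abs0.
have Dj : log_defect`_j.+1 = log_defect^`()`_j / j.+1%:R.
  by rewrite coef_deriv -[_ *+ _]mulr_natr mulfK ?Cp_natr_neq0.
have [lt_jN|le_Nj] := ltnP j N.
  have [Q QE] := dvdpP _ _ deriv_log_defect_dvd.
  by rewrite Dj QE coefMXn lt_jN !mul0r Cp_abs0.
rewrite Dj mulrAC (le_trans (log_term_abs _ _ _)) //.
  exact/abs_le1_polyP/deriv_log_defect_le1.
by rewrite He // leqW.
Qed.

End PowerDefect.

Lemma Cp_abs_expr_sub1 x m : abs (x - 1) < 1 -> abs (x ^+ m - 1) < 1.
Proof.
move=> x1; have ax : abs x <= 1.
  by rewrite -(subrK 1 x); apply: Cp_absD_le; rewrite ?Cp_abs1 // ltW.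
rewrite subrX1 absM (le_lt_trans _ x1) // -[leRHS]mulr1.
rewrite ler_wpM2l ?abs_ge0 //; apply: Cp_abs_sum_le => // i _.
by rewrite Cp_absX exprn_ile1 ?abs_ge0.
Qed.

Lemma plogX x m : abs (x - 1) < 1 -> plog abs (x ^+ m) = m%:R * plog abs x.
Proof.
(* The exponent 0 is treated apart because [log_defect_abs] assumes m > 0. *)
move=> x1; case: m => [|m].
  rewrite expr0 mul0r; apply: abs_cvg_unique (plog_cvg _) _.
    by rewrite subrr Cp_abs0.
  apply/abs_cvgP => e e0; exists 0%N => n _.
  by rewrite subrr horner_coef0 log_poly_coef0 subrr Cp_abs0.
apply: abs_cvg_unique (plog_cvg (Cp_abs_expr_sub1 m.+1 x1)) _.
apply/abs_cvgP => e e0.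
(* [log_defect_abs] gives only a weak inequality; the bound e / 2 makes the final one strict. *)
have [|N HN] := @natr_expr_small R (abs (x - 1)) (e / 2) _ (divr_gt0 e0 (ltr0n _ 2)).
  by rewrite abs_ge0.
have /abs_cvgP/(_ _ e0)[N' HN'] := plog_cvg x1.
exists (maxn N N') => n; rewrite geq_max => /andP[Nn N'n].
have -> : (log_poly n).[x ^+ m.+1 - 1] - m.+1%:R * plog abs x =
   (log_defect n m.+1).[x - 1] + m.+1%:R * ((log_poly n).[x - 1] - plog abs x).
  rewrite /log_defect !hornerE horner_comp !hornerE.
  by rewrite /= (addrC 1) addrK; ring.
apply: Cp_absD_lt.
  apply: (@le_lt_trans _ _ (e / 2)); last by rewrite gtr_pMr // invf_lt1 // ltr1n.
  apply: log_defect_abs => //; first by rewrite divr_ge0 ?ltW.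
  by move=> j nj; rewrite ltW // HN // (leq_trans Nn).
rewrite absM (le_lt_trans _ (HN' n N'n)) // -[leRHS]mul1r.
by rewrite ler_wpM2r ?abs_ge0 ?Cp_abs_nat_le1.
Qed.

(** * Powers of q differ from 1 *)

Lemma Cp_abs_exprn_sub1_coprime x m : abs (x - 1) < 1 -> coprime p m ->
  abs (x ^+ m - 1) = abs (x - 1).
Proof.
move=> x1 pm; rewrite subrX1 absM -[RHS]mulr1; congr (_ * _).
(* The cofactor of x - 1 is m, a unit of absolute value 1, up to terms of absolute value less than
   1. *)
have -> : \sum_(i < m) x ^+ i = m%:R + \sum_(i < m) (x ^+ i - 1).
  by rewrite big_split /= sumr_const card_ord mulNrn addrCA subrr addr0.
rewrite -[RHS](Cp_abs_coprime pm); apply: Cp_absD_dom.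
rewrite Cp_abs_coprime //; elim/big_ind: _; first by rewrite Cp_abs0.
  by move=> ? ?; exact: Cp_absD_lt.
by move=> i _; exact: Cp_abs_expr_sub1.
Qed.

(* Below the radius p^(-1/(p-1)) the term p (x - 1) dominates x^p - 1. *)
Lemma Cp_abs_exprp_sub1 x : abs (x - 1) ^+ p.-1 < p%:R^-1 -> x != 1 ->
  abs (x ^+ p - 1) = p%:R^-1 * abs (x - 1).
Proof.
set z := x - 1 => zp xN1.
have p0 := prime_gt0 p_prime.
have z0 : 0 < abs z.
  rewrite lt_def abs_ge0 andbT; apply: contra_neq xN1.
  by move=> /abs_eq0 /eqP; rewrite subr_eq0 => /eqP.
have z1 : abs z < 1.
  rewrite -(expr_lt1 (n := p.-1)) ?abs_ge0 //.
    by rewrite (lt_le_trans zp) // invf_le1 ?ltr0n // ler1n.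
  by rewrite -subn1 subn_gt0 prime_gt1.
(* The term z^p is smaller than p z because |z|^(p-1) < 1/p; the middle terms carry a factor p from
   the binomial coefficient and at least z^2. *)
have -> : x ^+ p - 1 = p%:R * z + (z ^+ p + \sum_(2 <= i < p) z ^+ i *+ 'C(p, i)).
  have -> : x = 1 + z by rewrite /z; ring.
  rewrite exprDn -(big_mkord xpredT (fun i => 1 ^+ (p - i) * z ^+ i *+ 'C(p, i))).
  rewrite big_nat_recr //= big_ltn // big_ltn ?prime_gt1 // binn bin1 bin0.
  rewrite !expr1n expr0 expr1 !mul1r !mulr1n -mulr_natl.
  under eq_bigr do rewrite expr1n mul1r.
  by ring.
rewrite -absp -absM; apply: Cp_absD_dom.
rewrite absM absp.
apply: Cp_absD_lt.
  by rewrite Cp_absX -[X in _ ^+ X](prednK p0) exprSr ltr_pM2r.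
rewrite big_seq_cond; elim/big_ind: _.
- by rewrite Cp_abs0 mulr_gt0 // invr_gt0 ltr0n.
- by move=> ? ?; exact: Cp_absD_lt.
move=> i; rewrite andbT mem_index_iota => /andP[i2 ip].
have /dvdnP[c ->] : (p %| 'C(p, i))%N by rewrite prime_dvd_bin // ip (ltnW i2).
rewrite -mulr_natl natrM !absM absp Cp_absX.
have pV : 0 < p%:R^-1 :> R by rewrite invr_gt0 ltr0n.
apply: (@le_lt_trans _ _ (p%:R^-1 * abs z ^+ i)).
  rewrite ler_wpM2r ?exprn_ge0 ?abs_ge0 // -[leRHS]mul1r.
  by rewrite ler_wpM2r ?(ltW pV) ?Cp_abs_nat_le1.
rewrite ltr_pM2l // -[ltRHS]expr1.
by rewrite ltr_iXn2l.
Qed.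

(** Write m = k p^v with k prime to p. Each p-th power scales the distance to 1 by 1/p, so it stays
    nonzero and within the radius; the k-th power then preserves it. The radius excludes primitive
    p-th roots of unity, which lie at distance exactly p^(-1/(p-1)) from 1. *)
Lemma Cp_exprn_neq1 x m : abs (x - 1) ^+ p.-1 < p%:R^-1 -> x != 1 -> (0 < m)%N ->
  x ^+ m != 1.
Proof.
move=> xp xN1 m0; have [k pk ->] := pfactor_coprime p_prime m0.
have p0 := prime_gt0 p_prime.
have iterp v : abs (x ^+ (p ^ v) - 1) ^+ p.-1 < p%:R^-1 /\ x ^+ (p ^ v) != 1.
  elim: v => [//|v [IH1 IH2]]; rewrite expnSr exprM.
  have E := Cp_abs_exprp_sub1 IH1 IH2; split.
    rewrite E (le_lt_trans _ IH1) // lerXn2r ?nnegrE ?mulr_ge0 ?invr_ge0 ?abs_ge0 //.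
    by rewrite ler_piMl ?abs_ge0 // invf_le1 ?ltr0n // ler1n.
  apply: contra_neq IH2 => IH2; move: E; rewrite IH2 subrr Cp_abs0 => /esym/eqP.
  rewrite mulf_eq0 invr_eq0 pnatr_eq0 gtn_eqF //= => /eqP /abs_eq0 /eqP.
  by rewrite subr_eq0 => /eqP.
have [v1 v2] := iterp (logn p m).
rewrite mulnC exprM; apply: contra_neq v2 => kE.
apply/eqP; rewrite -subr_eq0; apply/eqP/abs_eq0.
rewrite -(Cp_abs_exprn_sub1_coprime _ pk) ?kE ?subrr ?Cp_abs0 //.
rewrite -(expr_lt1 (n := p.-1)) ?abs_ge0 //.
  by rewrite (lt_le_trans v1) // invf_le1 ?ltr0n // ler1n.
by rewrite -subn1 subn_gt0 prime_gt1.
Qed.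

Lemma abs_lt_radius (r : R) : 0 <= r -> r < p%:R `^ (- (p.-1)%:R^-1) ->
  r ^+ p.-1 < p%:R^-1.
Proof.
have p0 : (0 < p.-1)%N by rewrite -subn1 subn_gt0 prime_gt1.
move=> r0 rp; have : r ^+ p.-1 < (p%:R `^ (- (p.-1)%:R^-1)) ^+ p.-1.
  by rewrite ltrXn2r ?nnegrE ?powR_ge0 ?gtn_eqF.
rewrite -(powR_mulrn _ (powR_ge0 _ _)) -powRrM mulNr mulVf.
  by rewrite powR_inv1 ?ler0n.
by rewrite pnatr_eq0 gtn_eqF.
Qed.
End PadicLogarithm.

(** * The ring of formal power series *)

(** A separate type that receives the Cauchy product as its multiplication, while addition stays the
    pointwise one of [nat -> K]. *)
Definition fps (K : fieldType) : Type := nat -> K.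

Section FpsRing.
Variable K : fieldType.
Implicit Types f g h : fps K.

Definition fps_trunc (n : nat) f : {poly K} := \poly_(i < n.+1) f i.

Lemma coef_fps_trunc n f i : (i <= n)%N -> (fps_trunc n f)`_i = f i.
Proof. by move=> le_in; rewrite coef_poly ltnS le_in. Qed.

(** Coefficients up to n of a product depend only on those of the factors, so the ring laws can be
    pulled back from [{poly K}]. The conclusion has the shape of the hypotheses so that it chains
    over iterated products. *)
Lemma coefM_fps_mul n (P Q : {poly K}) f g :
  (forall i, (i <= n)%N -> P`_i = f i) -> (forall i, (i <= n)%N -> Q`_i = g i) ->
  forall i, (i <= n)%N -> (P * Q)`_i = fps_mul f g i.
Proof.
move=> Pf Qg i le_in; rewrite coefM; apply: eq_bigr => j _.
rewrite Pf ?Qg ?(leq_trans (leq_subr _ _)) //.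
by rewrite (leq_trans _ le_in) // -ltnS.
Qed.

Definition fps_one : fps K := fun n => (n == 0%N)%:R.

Lemma fps_mulA : associative (@fps_mul K : fps K -> fps K -> fps K).
Proof.
move=> f g h; apply/funext => n.
have T f' i : (i <= n)%N -> (fps_trunc n f')`_i = f' i by exact: coef_fps_trunc.
rewrite -(coefM_fps_mul (T f) (coefM_fps_mul (T g) (T h))) //.
by rewrite mulrA (coefM_fps_mul (coefM_fps_mul (T f) (T g)) (T h)).
Qed.

Lemma fps_mulC : commutative (@fps_mul K : fps K -> fps K -> fps K).
Proof.
move=> f g; apply/funext => n.
have T f' i : (i <= n)%N -> (fps_trunc n f')`_i = f' i by exact: coef_fps_trunc.
by rewrite -(coefM_fps_mul (T f) (T g)) // mulrC (coefM_fps_mul (T g) (T f)).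
Qed.

Lemma fps_mul1 : left_id fps_one (@fps_mul K).
Proof.
move=> f; apply/funext => n; rewrite /fps_mul big_ord_recl subn0 mul1r.
by rewrite big1 ?addr0 // => i _; rewrite mul0r.
Qed.

HB.instance Definition _ := GRing.Zmodule.copy (fps K) (nat -> K).

Lemma fps_mulDl : left_distributive (@fps_mul K) (@GRing.add (fps K)).
Proof.
move=> f g h; apply/funext => n; rewrite /fps_mul -[RHS]big_split /=.
by apply: eq_bigr => i _; rewrite -mulrDl.
Qed.

Lemma fps_one_neq0 : fps_one != 0 :> fps K.
Proof. by apply/eqP => /(congr1 (@^~ 0%N)) /eqP; rewrite /= oner_eq0. Qed.

HB.instance Definition _ := GRing.Zmodule_isComNzRing.Build (fps K)
  fps_mulA fps_mulC fps_mul1 fps_mulDl fps_one_neq0.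

Lemma fps_mulE f g : f * g = fps_mul f g. Proof. by []. Qed.

Lemma fps_sumE n (F : 'I_n -> fps K) k :
  (\sum_(i < n) F i) k = \sum_(i < n) F i k.
Proof. by elim/big_ind2: _ => // _ f _ g <- <-. Qed.

Definition fps_const (c : K) : fps K := fun n => c *+ (n == 0%N).

Lemma fps_constM c f n : (fps_const c * f) n = c * f n.
Proof.
rewrite fps_mulE /fps_mul big_ord_recl subn0 big1 ?addr0 // => i _.
by rewrite /fps_const mul0r.
Qed.

Lemma fps_const_is_zmod_morphism : zmod_morphism fps_const.
Proof. by move=> a b; apply/funext => n; rewrite /fps_const mulrnBl. Qed.

Lemma fps_const_is_monoid_morphism : monoid_morphism fps_const.
Proof.
split=> [//|a b]; apply/funext => n.
by rewrite fps_constM /fps_const mulrnAr.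
Qed.

HB.instance Definition _ :=
  GRing.isZmodMorphism.Build K (fps K) fps_const fps_const_is_zmod_morphism.
HB.instance Definition _ :=
  GRing.isMonoidMorphism.Build K (fps K) fps_const fps_const_is_monoid_morphism.

(** The substitution t -> c t. *)
Definition fps_scale (c : K) f : fps K := fun n => c ^+ n * f n.

Lemma fps_scale_is_zmod_morphism c : zmod_morphism (fps_scale c).
Proof. by move=> f g; apply/funext => n; exact: mulrBr. Qed.

Lemma fps_scale_is_monoid_morphism c : monoid_morphism (fps_scale c).
Proof.
split=> [|f g]; apply/funext => n.
  by case: n => [|n]; rewrite /fps_scale ?mulr1 ?mulr0.
rewrite /fps_scale !fps_mulE /fps_mul mulr_sumr; apply: eq_bigr => i _.
by rewrite mulrACA -exprD subnKC // -ltnS.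
Qed.

HB.instance Definition _ c := GRing.isZmodMorphism.Build (fps K) (fps K)
  (fps_scale c) (fps_scale_is_zmod_morphism c).
HB.instance Definition _ c := GRing.isMonoidMorphism.Build (fps K) (fps K)
  (fps_scale c) (fps_scale_is_monoid_morphism c).

Lemma fps_scale_const c a : fps_scale c (fps_const a) = fps_const a.
Proof.
by apply/funext=> -[|n]; rewrite /fps_scale /fps_const ?mul1r ?mulr0.
Qed.

Definition fpsX : fps K := fun n => (n == 1%N)%:R.

Lemma fps_scaleX c : fps_scale c fpsX = fps_const c * fpsX.
Proof.
apply/funext=> n; rewrite fps_constM /fps_scale /fpsX.
by case: n => [|[|n]]; rewrite ?expr1 ?mulr0.
Qed.

Lemma fps_scale_exp c x : fps_scale c (fps_exp x) = fps_exp (c * x).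
Proof. by apply/funext=> n; rewrite /fps_scale /fps_exp exprMn mulrA. Qed.

Lemma fps_mulVr f : f 0%N != 0 -> (fps_inv f : fps K) * f = 1.
Proof. by move=> f0; apply/funext => n; apply: fps_mulVf. Qed.

(** * Exponential series and exponential generating functions *)

Hypothesis K0 : [pchar K] =i pred0.

Lemma fact_neq0 n : n`!%:R != 0 :> K.
Proof. by move/pcharf0P: K0 => ->; rewrite -lt0n fact_gt0. Qed.

Lemma fps_expD x y : (fps_exp (x + y) : fps K) = (fps_exp x : fps K) * fps_exp y.
Proof.
apply/funext => n; rewrite fps_mulE /fps_mul /fps_exp addrC exprDn mulr_suml.
apply: eq_bigr => i _; have le_in : (i <= n)%N by rewrite -ltnS.
apply: (canLR (mulfK (fact_neq0 _))).
rewrite -(bin_fact le_in) -[_ *+ _]mulr_natl !natrM.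
by field; rewrite !fact_neq0.
Qed.

Lemma fps_exp0 : fps_exp 0 = 1 :> fps K.
Proof.
by apply/funext=> -[|n]; rewrite /fps_exp ?expr0 ?divr1 // expr0n mul0r.
Qed.

Lemma fps_expX x n : (fps_exp x : fps K) ^+ n = fps_exp (n%:R * x).
Proof.
elim: n => [|n IHn]; first by rewrite mul0r fps_exp0.
by rewrite exprS IHn -fps_expD -natr1 mulrDl mul1r addrC.
Qed.

(** The product of exponential generating functions is a binomial convolution; this is the source of
    the sums over k. *)
Lemma fps_mul_egf f g n :
  n`!%:R * (f * g) n = \sum_(k < n.+1) 'C(n, k)%:R * (k`!%:R * f k) *
     ((n - k)`!%:R * g (n - k)%N).
Proof.
rewrite fps_mulE /fps_mul mulr_sumr; apply: eq_bigr => k _.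
have le_kn : (k <= n)%N by rewrite -ltnS.
by rewrite -(bin_fact le_kn) !natrM; ring.
Qed.
End FpsRing.

(** * The symmetric generating function *)

Section SymmetricSeries.
Variables (R : realType) (K : fieldType) (abs : K -> R).
Hypothesis K0 : [pchar K] =i pred0.
Variable q : K.
Hypothesis q_expX_neq1 : forall m, (0 < m)%N -> q ^+ m != 1.
Hypothesis plog_q : forall m, plog abs (q ^+ m) = m%:R * plog abs q.

Local Notation C := (@fps_const K).
Local Notation e x := (fps_exp x : fps K).
Local Notation U := (C q * e 1).
Local Notation L := (C (plog abs q) + @fpsX K).
Local Notation V m := (fps_inv (U ^+ m - 1) : fps K).

Lemma qexpX m : U ^+ m = C (q ^+ m) * e m%:R.
Proof. by rewrite exprMn -rmorphXn /= fps_expX // mulr1. Qed.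

(** The constant coefficient to be inverted is q^m - 1. *)
Lemma qexp_subr1_invK m : (0 < m)%N -> V m * (U ^+ m - 1) = 1.
Proof.
move=> m0; apply: fps_mulVr; rewrite qexpX.
change ((C (q ^+ m) * e m%:R) 0%N - 1 != 0).
by rewrite fps_constM /fps_exp expr0 divr1 mulr1 subr_eq0 q_expX_neq1.
Qed.

Lemma qbern_series_scale m : (0 < m)%N ->
  fps_scale m%:R (qbern_series abs (q ^+ m)) = C m%:R * L * V m.
Proof.
move=> m0.
set I : fps K := fps_inv (fun n => q ^+ m * fps_exp 1 n - (n == 0)%:R).
have -> : qbern_series abs (q ^+ m) = (C (m%:R * plog abs q) + @fpsX K) * I.
  by rewrite -plog_q.
have defI : (fun n => q ^+ m * fps_exp 1 n - (n == 0)%:R) = C (q ^+ m) * e 1 - 1.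
  by apply/funext=> n; rewrite -fps_constM.
have IV : fps_scale m%:R I = V m.
  have : fps_scale m%:R (I * (C (q ^+ m) * e 1 - 1)) = 1.
    rewrite /I defI fps_mulVr ?rmorph1 //.
    change ((C (q ^+ m) * e 1) 0%N - 1 != 0).
    by rewrite fps_constM /fps_exp expr0 divr1 mulr1 subr_eq0 q_expX_neq1.
  rewrite rmorphM rmorphB rmorphM rmorph1 /= fps_scale_const fps_scale_exp.
  rewrite mulr1 -qexpX => IU.
  (* The rescaled [I] and [V m] are both inverse to [U ^+ m - 1], hence equal. *)
  have := congr1 ( *%R (fps_scale m%:R I)) (qexp_subr1_invK m0).
  by rewrite mulrCA IU !mulr1.
rewrite rmorphM rmorphD /= IV fps_scale_const fps_scaleX rmorphM /=.
by ring.
Qed.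

(** The factor m^k on the left is the effect of t -> m t on the coefficient of t^k. *)
Lemma qbern_poly_scale k m x : (0 < m)%N ->
  (qbern_poly abs k (q ^+ m)).[x] * m%:R ^+ k =
  k`!%:R * (C m%:R * L * V m * e (m%:R * x)) k.
Proof.
move=> m0; rewrite qbern_poly_gen // -qbern_series_scale // -fps_scale_exp.
by rewrite -rmorphM /= /fps_scale -mulrA; congr (_ * _); rewrite mulrC.
Qed.

(* (log q + t)^2 abc (u^abc - 1) e^(abc (y1 + y2) t)
     / ((u^ab - 1) (u^ac - 1) (u^bc - 1)),  where u = q e^t *)
Definition sym_gen (a b c : nat) (y1 y2 : K) : fps K :=
  C (a * b * c)%:R * L ^+ 2 * (U ^+ (a * b * c) - 1) *
  V (a * b)%N * V (a * c)%N * V (b * c)%N * e ((a * b * c)%:R * (y1 + y2)).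

Lemma sym_genE (a b c n : nat) (y1 y2 : K) :
  (0 < a)%N -> (0 < b)%N -> (0 < c)%N ->
  a%:R ^ (n%:Z - 1) *
    \sum_(k < n.+1) 'C(n, k)%:R * (qbern_poly abs k (q ^+ (a * b))).[c%:R * y1]
      * c%:R ^+ (n - k) * b%:R ^+ k
      * \sum_(i < a) q ^+ (b * c * i)
          * (qbern_poly abs (n - k) (q ^+ (a * c))).[b%:R * y2 + b%:R / a%:R * i%:R]
  = n`!%:R * sym_gen a b c y1 y2 n.
Proof.
move=> a0 b0 c0.
have aN0 : a%:R != 0 :> K by move/pcharf0P: K0 => ->; rewrite -lt0n.
have ab0 : (0 < a * b)%N by rewrite muln_gt0 a0.
have ac0 : (0 < a * c)%N by rewrite muln_gt0 a0.
have bc0 : (0 < b * c)%N by rewrite muln_gt0 b0.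
(* [F] generates the outer Bernoulli values and [H] the inner sums over i; the binomial convolution
   is the product [F * H]. *)
set F := C (a * b)%:R * L * V (a * b)%N * e ((a * b)%:R * (c%:R * y1)).
pose G i := C (a * c)%:R * L * V (a * c)%N *
   e ((a * c)%:R * (b%:R * y2 + b%:R / a%:R * i%:R)).
pose H : fps K := \sum_(i < a) C (q ^+ (b * c * i)) * G i.
(* The shift b i / a contributes e^(b c i t), which joins q^(b c i) to form u^(b c i); the geometric
   sum over i < a is (u^(abc) - 1) / (u^(bc) - 1). *)
have HE : H = C (a * c)%:R * L * V (a * c)%N * e ((a * b * c)%:R * y2) *
    ((U ^+ (a * b * c) - 1) * V (b * c)%N).
  have -> : H = C (a * c)%:R * L * V (a * c)%N * e ((a * b * c)%:R * y2) *
     \sum_(i < a) (U ^+ (b * c)) ^+ i.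
    rewrite mulr_sumr; apply: eq_bigr => i _; rewrite /G -exprM (qexpX (b * c * i)).
    have -> : (a * c)%:R * (b%:R * y2 + b%:R / a%:R * i%:R) =
        (a * b * c)%:R * y2 + (b * c * i)%:R :> K.
      by rewrite !natrM; field.
    by rewrite fps_expD //; ring.
  congr (_ * _); have -> : (a * b * c = b * c * a)%N by rewrite -mulnA mulnC.
  rewrite (exprM _ (b * c) a) subrX1 [RHS]mulrC mulrA qexp_subr1_invK ?mul1r //.
have -> : sym_gen a b c y1 y2 = C a%:R^-1 * (F * H).
  rewrite HE /F /sym_gen (mulrDr _ y1) fps_expD //.
  have -> : (a * b)%:R * (c%:R * y1) = (a * b * c)%:R * y1 :> K.
    by rewrite !natrM; ring.
  have -> : (a * b * c)%:R = a%:R^-1 * ((a * b)%:R * (a * c)%:R) :> K.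
    by rewrite !natrM; field.
  by rewrite !rmorphM /=; ring.
rewrite fps_constM mulrCA fps_mul_egf.
(* The exponent n - 1 is an integer, equal to -1 when n = 0. The factor a^n is later split as a^k
   a^(n-k) to complete (a b)^k and (a c)^(n-k). *)
have -> : a%:R ^ (n%:Z - 1) = a%:R^-1 * a%:R ^+ n :> K.
  by rewrite expfzDr // mulrC.
rewrite -mulrA mulr_sumr; congr (_ * _); apply: eq_bigr => k _.
have le_kn : (k <= n)%N by rewrite -ltnS.
rewrite -qbern_poly_scale //.
have -> : (n - k)`!%:R * H (n - k)%N = (a * c)%:R ^+ (n - k) * \sum_(i < a) q ^+ (b * c * i)
    * (qbern_poly abs (n - k) (q ^+ (a * c))).[b%:R * y2 + b%:R / a%:R * i%:R].
  rewrite /H fps_sumE !mulr_sumr; apply: eq_bigr => i _.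
  by rewrite fps_constM mulrCA -qbern_poly_scale // [RHS]mulrC mulrA.
rewrite !natrM !exprMn -{1}(subnKC le_kn) exprD.
by ring.
Qed.

(** Together with [sym_genAC] this gives every permutation of the weights; y1 and y2 enter only
    through their sum and stay in place. *)
Lemma sym_genCA a b c y1 y2 : sym_gen a b c y1 y2 = sym_gen b a c y1 y2.
Proof. by rewrite /sym_gen (mulnC b a); ring. Qed.

Lemma sym_genAC a b c y1 y2 : sym_gen a b c y1 y2 = sym_gen a c b y1 y2.
Proof. by rewrite /sym_gen (mulnAC a c b) (mulnC c b); ring. Qed.

End SymmetricSeries.

(** * The six orderings of the weights *)

Theorem theorem4p5 (p : nat) (p_prime : prime p)
  (R : realType) (K : fieldType) (abs : K -> R) (K_Cp : is_Cp abs p)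
  (q : K) (q_neq1 : q != 1)
  (q_near1 : abs (q - 1) < p%:R `^ (- (p.-1)%:R^-1))
  (w1 w2 w3 : nat) (w1_gt0 : (0 < w1)%N) (w2_gt0 : (0 < w2)%N)
  (w3_gt0 : (0 < w3)%N) (n : nat) (y1 y2 : K)
  (y1_Zp : Zp abs y1) (y2_Zp : Zp abs y2) :
  let B (k w : nat) (x : K) := (qbern_poly abs k (q ^+ w)).[x] in
  let E1 := w1%:R ^ (n%:Z - 1) *
    \sum_(k < n.+1) 'C(n, k)%:R * B k (w1 * w2)%N (w3%:R * y1)
      * w3%:R ^+ (n - k) * w2%:R ^+ k
      * \sum_(i < w1) q ^+ (w2 * w3 * i)
          * B (n - k)%N (w1 * w3)%N (w2%:R * y2 + w2%:R / w1%:R * i%:R) in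
  let E2 := w1%:R ^ (n%:Z - 1) *
    \sum_(k < n.+1) 'C(n, k)%:R * B k (w1 * w3)%N (w2%:R * y1)
      * w2%:R ^+ (n - k) * w3%:R ^+ k
      * \sum_(i < w1) q ^+ (w2 * w3 * i)
          * B (n - k)%N (w1 * w2)%N (w3%:R * y2 + w3%:R / w1%:R * i%:R) in
  let E3 := w2%:R ^ (n%:Z - 1) *
    \sum_(k < n.+1) 'C(n, k)%:R * B k (w1 * w2)%N (w3%:R * y1)
      * w3%:R ^+ (n - k) * w1%:R ^+ k
      * \sum_(i < w2) q ^+ (w1 * w3 * i)
          * B (n - k)%N (w2 * w3)%N (w1%:R * y2 + w1%:R / w2%:R * i%:R) in
  let E4 := w2%:R ^ (n%:Z - 1) *
    \sum_(k < n.+1) 'C(n, k)%:R * B k (w2 * w3)%N (w1%:R * y1)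
      * w1%:R ^+ (n - k) * w3%:R ^+ k
      * \sum_(i < w2) q ^+ (w1 * w3 * i)
          * B (n - k)%N (w1 * w2)%N (w3%:R * y2 + w3%:R / w2%:R * i%:R) in
  let E5 := w3%:R ^ (n%:Z - 1) *
    \sum_(k < n.+1) 'C(n, k)%:R * B k (w1 * w3)%N (w2%:R * y1)
      * w2%:R ^+ (n - k) * w1%:R ^+ k
      * \sum_(i < w3) q ^+ (w1 * w2 * i)
          * B (n - k)%N (w2 * w3)%N (w1%:R * y2 + w1%:R / w3%:R * i%:R) in
  let E6 := w3%:R ^ (n%:Z - 1) *
    \sum_(k < n.+1) 'C(n, k)%:R * B k (w2 * w3)%N (w1%:R * y1)
      * w1%:R ^+ (n - k) * w2%:R ^+ k
      * \sum_(i < w3) q ^+ (w1 * w2 * i)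
          * B (n - k)%N (w1 * w3)%N (w2%:R * y2 + w2%:R / w3%:R * i%:R) in
  [/\ E1 = E2, E2 = E3, E3 = E4, E4 = E5 & E5 = E6].
Proof.
move=> B E1 E2 E3 E4 E5 E6.
have K0 := Cp_pchar0 p_prime K_Cp.
have q_rad := abs_lt_radius p_prime (Cp_abs_ge0 K_Cp _) q_near1.
have q1 : abs (q - 1) < 1.
  rewrite -(expr_lt1 (n := p.-1)) ?(Cp_abs_ge0 K_Cp) //.
    by rewrite (lt_le_trans q_rad) // invf_le1 ?ltr0n ?ler1n ?prime_gt0.
  by rewrite -subn1 subn_gt0 prime_gt1.
have qX m := @Cp_exprn_neq1 _ p_prime _ _ _ K_Cp q m q_rad q_neq1.
have qlog m := plogX p_prime K_Cp m q1.
(* In each expression a is the length of the inner sum, b the weight raised to the power k, and c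
   the one raised to n - k. *)
pose S a b c := n`!%:R * sym_gen abs q a b c y1 y2 n.
have SE := @sym_genE _ _ abs K0 q qX qlog _ _ _ n y1 y2.
have E1E : E1 = S w1 w2 w3 by exact: SE.
have E2E : E2 = S w1 w3 w2 by rewrite /E2 (mulnC w2); exact: SE.
have E3E : E3 = S w2 w1 w3 by rewrite /E3 (mulnC w1 w2); exact: SE.
have E4E : E4 = S w2 w3 w1.
  by rewrite /E4 (mulnC w1 w3) (mulnC w1 w2); exact: SE.
have E5E : E5 = S w3 w1 w2.
  by rewrite /E5 (mulnC w1 w3) (mulnC w2 w3); exact: SE.
have E6E : E6 = S w3 w2 w1.
  by rewrite /E6 (mulnC w2 w3) (mulnC w1 w3) (mulnC w1 w2); exact: SE.
have SCA a b c : S a b c = S b a c by rewrite /S sym_genCA.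
have SAC a b c : S a b c = S a c b by rewrite /S sym_genAC.
rewrite E1E E2E E3E E4E E5E E6E; split; first exact: SAC.
- by rewrite SAC SCA.
- exact: SAC.
- by rewrite SCA SAC.
- exact: SAC.
Qed.
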